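(* Let $F$ be a field, let $m(x)=x^3+ax^2+bx+c\in F[x]$ be irreducible, and let $S\subseteq\mathcal{C}(m)$. (1) If there exist distinct $A,B,C\in S$ such that $B-A$ is invertible and $C-A$ is singular, then $S$ is core. (2) If there exist distinct $A,B,C\in S$ such that $\mathfrak{n}(B-A)\neq\mathfrak{n}(C-A)$, then $S$ is core. (3) If $F=\mathbb{F}_q$, then there exist core subsets of $\mathcal{C}(m)$ of cardinality $n$ for all $3\leq n\leq (q^3-q^2)(q^3-q)$.
   Context: $M_3(F)$ is the ring of $3\times 3$ matrices over $F$. $\mathcal{C}(m)$ is the set of all $A\in M_3(F)$ whose minimal polynomial is $m$. For $X\in M_3(F)$, $\mathfrak{n}(X)=\{v\in F^3 : vX=0\}$ is the left nullspace of $X$, where $F^3$ denotes row vectors. For polynomials in $M_3(F)[x]$ the indeterminate $x$ is central, and $f(x)=\sum_i \alpha_i x^i$ is evaluated at $A\in M_3(F)$ by right evaluation, $f(A)=\sum_i \alpha_i A^i$. For $S\subseteq M_3(F)$, the null ideal is $N(S)=\{f\in M_3(F)[x] : f(A)=0 \text{ for all } A\in S\}$. The set $S$ is called core if $N(S)$ is a two-sided ideal of $M_3(F)[x]$. *)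

(* Defs.v *)
From HB Require Import structures.
From mathcomp Require Import all_boot all_order all_algebra.
From mathcomp Require Import classical_sets.

Set Implicit Arguments.
Unset Strict Implicit.
Unset Printing Implicit Defensive.

Import GRing.Theory.
Local Open Scope classical_set_scope.
Local Open Scope ring_scope.

(* [idealr_closed] is not used here: it is one-sided, boolean, and excludes   *)
(* the improper ideal (which is the null ideal of the empty set).             *)
Definition two_sided_ideal (R : nzRingType) (I : set R) : Prop :=
  [/\ I 0,
      forall f g, I f -> I g -> I (f - g),
      forall r f, I f -> I (r * f)
    & forall f r, I f -> I (f * r)].

Definition minpoly_class (F : fieldType) (m : {poly F}) : set 'M[F]_3 :=
  [set A | mxminpoly A = m].

Definition left_nullspace (F : fieldType) (X : 'M[F]_3) : set 'rV[F]_3 :=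
  [set v | v *m X = 0].

(* Over a noncommutative ring, [f.[A]] is \sum_i f`_i * A ^+ i, i.e. the      *)
(* evaluation with the coefficients on the left of the powers of A.           *)
Definition null_ideal (F : fieldType) (S : set 'M[F]_3) :
    set {poly 'M[F]_3} :=
  [set f | forall A, S A -> f.[A] = 0].

Definition core (F : fieldType) (S : set 'M[F]_3) : Prop :=
  two_sided_ideal (null_ideal S).

(* Main.v *)
(* Let K = F[x]/(m) and let t be the class of x. Every A in C(m) has a column *)
(* eigenvector h_A over K for the eigenvalue t; its entries are F-independent *)
(* since m is irreducible of degree 3. For f in M_3(F)[x], f(A) = 0 if and    *)
(* only if f(t) h_A = 0, where f |-> f(t) is a ring morphism into M_3(K). If  *)
(* h_A, h_B, h_C are a basis of K^3 for some A, B, C in S, then N(S) is the   *)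
(* kernel of this morphism, so S is core. If k1 h_A + k2 h_B + k3 h_C = 0     *)
(* instead, applying A - t gives k2 (B - A) h_B = - k3 (C - A) h_C, which     *)
(* forces B - A and C - A to have the same left nullspace. For (3), fix a row *)
(* e <> 0: A |-> (eA, eA^2) maps C(m) onto the pairs (y, z) with (e, y, z)    *)
(* a basis, and the pairs (y, z), (y, z + e), (y + e, z) give a triple to     *)
(* which (2) applies.                                                         *)
Require Import Defs.
From HB Require Import structures.
From mathcomp Require Import all_boot all_order all_algebra.
From mathcomp Require Import fieldext classical_sets.

Set Implicit Arguments.
Unset Strict Implicit.
Unset Printing Implicit Defensive.

Import GRing.Theory.
Local Open Scope classical_set_scope.
Local Open Scope ring_scope.

(** The outline above is carried by [eigencol_independent] (an eigencolumn has entries independent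
    over F), [lift_evalP] (f(A) h_A = f(t) h_A) and [eq_left_nullspace_dependent] (dependent
    eigencolumns give equal left nullspaces). Together they yield (2), which is
    [core_left_nullspace_neq]. Part (1) follows from (2), since an invertible matrix has zero left
    nullspace and a singular one does not. For (3), a set of matrices in C(m) containing one triple
    as in (2) is core, so every size from 3 to |C(m)| occurs; [minpoly_class_cyclic] and
    [card_flag_pairs_ge] bound |C(m)| from below. *)

(** * Eigencolumns over an extension field *)

Lemma nonunit_mulmx_col (F : fieldType) (n : nat) (A : 'M[F]_n) :
  A \notin unitmx -> exists2 h : 'cV_n, h != 0 & A *m h = 0.
Proof.
rewrite -unitmx_tr unitmxE unitfE negbK => /det0P[v v0 vA].
exists v^T; first by rewrite trmx_eq0.
by apply: trmx_inj; rewrite trmx_mul trmxK trmx0.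
Qed.

Lemma root_mxminpoly_eigencol (F : fieldType) (n : nat) (A : 'M[F]_n.+1)
    (t : F) :
  root (mxminpoly A) t -> exists2 h : 'cV_n.+1, h != 0 & A *m h = t *: h.
Proof.
rewrite -eigenvalue_root_min /eigenvalue kermx_eq0 row_free_unit.
case/nonunit_mulmx_col=> h h0 /eqP; rewrite mulmxBl mul_scalar_mx subr_eq0.
by move/eqP=> Ah; exists h.
Qed.

(** A linear relation among the rows reads v p(A) = 0 with deg p <= n. If p is nonzero, it is
    coprime to the minimal polynomial, so Bezout inverts p(A) and v = 0. *)
Lemma cyclic_mx_unit (F : fieldType) (n : nat) (A : 'M[F]_n.+1)
    (v : 'rV[F]_n.+1) :
  irreducible_poly (mxminpoly A) -> size (mxminpoly A) = n.+2 -> v != 0 ->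
  \matrix_(i < n.+1) (v *m A ^+ i) \in unitmx.
Proof.
move=> irrA szA v0; rewrite -row_free_unit; apply: inj_row_free => r rV0.
have vr0 : v *m horner_mx A (rVpoly r) = 0.
  rewrite -[RHS]rV0 (mulmx_sum_row r) /rVpoly poly_def raddf_sum /= mulmx_sumr.
  apply: eq_bigr => i _; rewrite valK /= horner_mxZ rmorphXn /= horner_mx_X.
  by rewrite rowK scalemxAr.
apply: contraNeq v0 => r0.
have rp0 : rVpoly r != 0.
  by apply: contraNneq r0 => r0; rewrite -[r]rVpolyK r0 linear0.
have: coprimep (mxminpoly A) (rVpoly r).
  rewrite irreducible_poly_coprime //; apply/negP => /(dvdp_leq rp0).
  by rewrite szA ltnNge size_poly.
case/Bezout_eq1_coprimepP=> -[p q] /= /(congr1 (horner_mx A)).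
rewrite rmorphD !rmorphM rmorph1 /= mx_root_minpoly mulr0 add0r => qr1.
rewrite -[v]mulmx1 -[1%:M]/(1 : 'M_n.+1) -qr1 (comm_horner_mx2 A q) mulmxA.
by rewrite vr0 mul0mx.
Qed.

(** If a row v of V is nonzero, the vectors v A^i form an invertible matrix; it kills h because v
    A^i h = t^i v h = 0, so h = 0. *)
Lemma eigencol_independent (F L : fieldType) (f : {rmorphism F -> L}) (n : nat)
    (A : 'M[F]_n.+1) (t : L) (h : 'cV[L]_n.+1) (k : nat) (V : 'M[F]_(k, n.+1)) :
  irreducible_poly (mxminpoly A) -> size (mxminpoly A) = n.+2 ->
  h != 0 -> map_mx f A *m h = t *: h -> map_mx f V *m h = 0 -> V = 0.
Proof.
move=> irrA szA h0 Ah Vh; apply/row_matrixP=> j; rewrite row0.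
apply: contraNeq h0 => v0.
have vA := cyclic_mx_unit irrA szA v0.
have Aih i : map_mx f (A ^+ i) *m h = t ^+ i *: h.
  elim: i => [|i IHi]; first by rewrite !expr0 map_mx1 mul1mx scale1r.
  by rewrite exprS map_mxM -mulmxA IHi -scalemxAr Ah scalerA exprSr.
rewrite -(map_unitmx f) in vA; rewrite -(mulKmx vA h).
apply/eqP; rewrite [X in _ *m X](_ : _ = 0) ?mulmx0 //.
apply/row_matrixP=> i; rewrite row0 row_mul -map_row rowK map_mxM -mulmxA Aih.
by rewrite -scalemxAr map_row -row_mul Vh row0 scaler0.
Qed.

(** * Evaluation at a scalar matrix *)

Lemma comm_map_scalar_mx (F L : fieldType) (f : {rmorphism F -> L}) (n : nat)
    (t : L) :
  commr_rmorph (map_mx f : 'M[F]_n.+1 -> 'M[L]_n.+1) t%:M.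
Proof. by move=> U; rewrite /GRing.comm -!mulmxE scalar_mxC. Qed.

(** Evaluation at [t%:M]: this matrix commutes with all coefficients, which makes the evaluation
    multiplicative. *)
Definition lift_eval (F L : fieldType) (f : {rmorphism F -> L}) (n : nat)
    (t : L) : {poly 'M[F]_n.+1} -> 'M[L]_n.+1 :=
  horner_morph (@comm_map_scalar_mx F L f n t).

Lemma lift_evalM (F L : fieldType) (f : {rmorphism F -> L}) (n : nat) (t : L)
    (g1 g2 : {poly 'M[F]_n.+1}) :
  lift_eval f t (g1 * g2) = lift_eval f t g1 * lift_eval f t g2.
Proof. exact: rmorphM. Qed.

(* Applied to an eigenvector, right evaluation at [A] becomes the ring        *)
(* morphism [lift_eval], which does not depend on [A].                        *)
Lemma lift_evalP (F L : fieldType) (f : {rmorphism F -> L}) (n : nat)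
    (A : 'M[F]_n.+1) (t : L) (h : 'cV[L]_n.+1) (g : {poly 'M[F]_n.+1}) :
  map_mx f A *m h = t *: h -> map_mx f g.[A] *m h = lift_eval f t g *m h.
Proof.
move=> Ah; elim/poly_ind: g => [|g U IHg].
  by rewrite /lift_eval rmorph0 horner0 map_mx0.
have -> : lift_eval f t (g * 'X + U%:P) = lift_eval f t g * t%:M + map_mx f U.
  by rewrite /lift_eval rmorphD rmorphM /= horner_morphX horner_morphC.
rewrite hornerMXaddC map_mxD map_mxM !mulmxDl -!mulmxA Ah.
by rewrite mul_scalar_mx -!scalemxAr IHg.
Qed.

(** * The criterion on left nullspaces *)

Lemma eq_left_nullspace_dependent (F L : fieldType) (f : {rmorphism F -> L})
    (m : {poly F}) (A B C : 'M[F]_3) (t k1 k2 k3 : L) (hA hB hC : 'cV[L]_3) :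
  irreducible_poly m -> size m = 4%N ->
  minpoly_class m B -> minpoly_class m C -> A <> B -> A <> C ->
  hA != 0 -> hB != 0 -> hC != 0 ->
  map_mx f A *m hA = t *: hA -> map_mx f B *m hB = t *: hB ->
  map_mx f C *m hC = t *: hC ->
  k1 *: hA + k2 *: hB + k3 *: hC = 0 -> [|| k1 != 0, k2 != 0 | k3 != 0] ->
  left_nullspace (B - A) = left_nullspace (C - A).
Proof.
move=> irrm szm mB mC nAB nAC hA0 hB0 hC0 AhA BhB ChC kh kn0.
have indep X (h : 'cV_3) k (V : 'M_(k, 3)) : minpoly_class m X -> h != 0 ->
    map_mx f X *m h = t *: h -> map_mx f V *m h = 0 -> V = 0.
  by move=> mX; apply: eigencol_independent; rewrite mX.
(* Subtract A times the relation from t times the relation; the [hA] terms cancel. *)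
have kBC : k2 *: (map_mx f (B - A) *m hB) = - (k3 *: (map_mx f (C - A) *m hC)).
  apply/eqP; rewrite -addr_eq0 !map_mxB !mulmxBl BhB ChC !scalerBr.
  have kAh : k1 *: (t *: hA) + k2 *: (map_mx f A *m hB)
      + k3 *: (map_mx f A *m hC) = 0.
    by rewrite -AhA !scalemxAr -!mulmxDr kh mulmx0.
  have kth : k1 *: (t *: hA) + k2 *: (t *: hB) + k3 *: (t *: hC) = 0.
    by rewrite !scalerA ![_ * t]mulrC -!scalerA -!scalerDr kh scaler0.
  have := f_equal2 (fun x y => x - y) kth kAh.
  by rewrite opprD addrACA opprD [X in X + _]addrACA !subrr add0r => ->.
(* If k2 = 0, then k3 (C - A) h_C = 0: either k3 = 0, leaving k1 h_A = 0, or independence of the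
   entries of h_C gives C = A. *)
have k20 : k2 != 0.
  apply: contraTneq kn0 => k20; move: kBC; rewrite k20 scale0r => /eqP.
  rewrite eq_sym oppr_eq0 scaler_eq0 => /orP[/eqP k30|/eqP/(indep _ _ _ _ mC)].
    move/eqP: kh; rewrite k20 k30 !scale0r !addr0 scaler_eq0 (negPf hA0) orbF.
    by move=> ->; rewrite eqxx.
  by move=> /(_ hC0 ChC)/eqP; rewrite subr_eq0 => /eqP/esym/nAC.
have k30 : k3 != 0.
  apply: contra_neq k20 => k30; move: kBC; rewrite k30 scale0r oppr0 => /eqP.
  rewrite scaler_eq0 => /orP[/eqP//|/eqP/(indep _ _ _ _ mB)].
  by move=> /(_ hB0 BhB)/eqP; rewrite subr_eq0 => /eqP/esym/nAB.
(* Multiplying [kBC] on the left by v shows that v (B - A) h_B and v (C - A) h_C vanish together;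
   independence then removes h_B and h_C. *)
apply/seteqP; split=> v /= vX.
- apply: (indep C hC) => //; apply: (scalerI k30).
  rewrite map_mxM -mulmxA scalemxAr -[_ *: _]opprK -kBC mulmxN -scalemxAr.
  by rewrite mulmxA -map_mxM vX map_mx0 mul0mx !scaler0 oppr0.
- apply: (indep B hB) => //; apply: (scalerI k20).
  rewrite map_mxM -mulmxA scalemxAr kBC mulmxN -scalemxAr mulmxA.
  by rewrite -map_mxM vX map_mx0 mul0mx !scaler0 oppr0.
Qed.

Lemma core_left_nullspace_neq (F : fieldType) (m : {poly F}) (S : set 'M[F]_3)
    (A B C : 'M[F]_3) :
  irreducible_poly m -> size m = 4%N -> S `<=` minpoly_class m ->
  S A -> S B -> S C -> A <> B -> A <> C ->
  left_nullspace (B - A) <> left_nullspace (C - A) -> core S.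
Proof.
move=> irrm szm Sm SA SB SC nAB nAC nBC.
have [L _ [t mt _]] := irredp_FAdjoin irrm.
pose f : {rmorphism F -> L} := in_alg L.
have eig X : S X -> exists2 h : 'cV_3, h != 0 & map_mx f X *m h = t *: h.
  by move=> /Sm mX; apply: root_mxminpoly_eigencol; rewrite mxminpoly_map mX.
have evP X (h : 'cV_3) g : S X -> h != 0 -> map_mx f X *m h = t *: h ->
    g.[X] = 0 <-> lift_eval f t g *m h = 0.
  move=> /Sm mX h0 Xh; rewrite -(lift_evalP g Xh).
  split=> [->|]; first by rewrite map_mx0 mul0mx.
  by apply: eigencol_independent (h0) (Xh); rewrite mX.
have [hA hA0 AhA] := eig A SA.
have [hB hB0 BhB] := eig B SB.
have [hC hC0 ChC] := eig C SC.
(* The width [1 + (1 + 1)] is convertible to 3, so both block lemmas and square-matrix lemmas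
   apply. *)
pose H : 'M[L]_(3, 1 + (1 + 1)) := row_mx hA (row_mx hB hC).
have uH : (H : 'M_3) \in unitmx.
  apply/negPn/negP => /nonunit_mulmx_col[k k0 Hk].
  apply: nBC; pose k' : 'cV[L]_(1 + (1 + 1)) := k.
  apply: (@eq_left_nullspace_dependent F L f m A B C t (usubmx k' 0 0)
    (usubmx (dsubmx k') 0 0) (dsubmx (dsubmx k') 0 0) hA hB hC) => //.
  - exact: Sm.
  - exact: Sm.
  - rewrite -!mul_mx_scalar -!mx11_scalar -addrA -!mul_row_col !vsubmxK.
    exact: Hk.
  - apply: contraNT k0.
    rewrite !negb_or !negbK => /and3P[/eqP k1 /eqP k2 /eqP k3].
    change (k' == 0); rewrite -[k']vsubmxK -[dsubmx k']vsubmxK.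
    rewrite [usubmx k']mx11_scalar [usubmx (dsubmx k')]mx11_scalar.
    rewrite [dsubmx (dsubmx k')]mx11_scalar k1 k2 k3.
    by rewrite !raddf0 !col_mx0.
(* The null ideal lies in the kernel of a ring morphism; by [evP] it is that kernel, hence
   two-sided. *)
have ker0 g : null_ideal S g -> lift_eval f t g = 0.
  move=> Sg; have gH : lift_eval f t g *m H = 0.
    rewrite /H !mul_mx_row.
    rewrite (proj1 (evP A hA g SA hA0 AhA) (Sg A SA)).
    rewrite (proj1 (evP B hB g SB hB0 BhB) (Sg B SB)).
    by rewrite (proj1 (evP C hC g SC hC0 ChC) (Sg C SC)) !row_mx0.
  by rewrite -[LHS](mulmxK uH) gH mul0mx.
split=> /=.
- by move=> X _; rewrite horner0.
- by move=> g1 g2 g10 g20 X SX; rewrite hornerD hornerN g10 // g20 // subr0.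
- move=> r g Sg X SX; have [h h0 Xh] := eig X SX.
  by apply/(evP X h _ SX h0 Xh); rewrite lift_evalM (ker0 g Sg) mulr0 mul0mx.
- move=> g r Sg X SX; have [h h0 Xh] := eig X SX.
  by apply/(evP X h _ SX h0 Xh); rewrite lift_evalM (ker0 g Sg) mul0r mul0mx.
Qed.

(** * Constructing and counting matrices with minimal polynomial m *)

Lemma minpoly_class_annihilated (F : fieldType) (m : {poly F}) (A : 'M[F]_3) :
  irreducible_poly m -> m \is monic -> horner_mx A m = 0 -> minpoly_class m A.
Proof.
move=> irrm monm /mxminpoly_min Am; apply/eqP.
rewrite -eqp_monic ?mxminpoly_monic //; apply: irrm.2 => //.
by rewrite size_mxminpoly eqSS -lt0n mxminpoly_nonconstant.
Qed.

Lemma minpoly_class_cyclic (F : fieldType) (a b c : F) (m : {poly F})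
    (e y z : 'rV[F]_3) :
  m = 'X^3 + a *: 'X^2 + b *: 'X + c%:P -> irreducible_poly m ->
  m \is monic ->
  (col_mx e (col_mx y z) : 'M_3) \in unitmx ->
  exists A, [/\ minpoly_class m A, e *m A = y & y *m A = z].
Proof.
move=> mE irrm monm; set P : 'M_3 := col_mx e _ => uP.
(* A is the companion matrix of m in the basis e, y, z; this image of z makes e m(A) = 0, and y, z
   follow since A commutes with m(A). *)
pose w := - (a *: z + b *: y + c *: e).
have [A PA] : exists A : 'M_3,
    col_mx (e *m A) (col_mx (y *m A) (z *m A)) = col_mx y (col_mx z w).
  exists (invmx P *m (col_mx y (col_mx z w) : 'M_3)).
  by rewrite -!mul_col_mx; apply: mulKVmx.
have /eq_col_mx[eA /eq_col_mx[yA zA]] := PA.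
exists A; split=> //; apply: minpoly_class_annihilated => //.
have mA : horner_mx A m = A *m A *m A + a *: (A *m A) + b *: A + c%:M.
  rewrite mE !rmorphD /= !horner_mxZ !rmorphXn /= horner_mx_X horner_mx_C.
  by rewrite !exprS expr0 mulr1 mulrA.
have em : e *m horner_mx A m = 0.
  rewrite mA !mulmxDr -!scalemxAr !mulmxA mul_mx_scalar eA yA zA.
  by rewrite -!addrA addrC /w !addrA addrN.
have comA : A *m horner_mx A m = horner_mx A m *m A.
  by rewrite -{1 4}[A]horner_mx_X; apply: comm_horner_mx2.
have ym : y *m horner_mx A m = 0 by rewrite -eA -mulmxA comA mulmxA em mul0mx.
have zm : z *m horner_mx A m = 0 by rewrite -yA -mulmxA comA mulmxA ym mul0mx.
rewrite -[LHS](mulKmx uP).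
suff -> : P *m horner_mx A m = 0 by rewrite mulmx0.
apply: etrans (mul_col_mx e (col_mx y z) (horner_mx A m)) _.
by rewrite mul_col_mx em ym zm !col_mx0.
Qed.

(** For e nonzero, the pairs extending e to a free family. Spans are written as images so that their
    sizes are bounded by those of the index types. *)
Definition flag_pairs (F : finFieldType) (n : nat) (e : 'rV[F]_n) :
    {set 'rV[F]_n * 'rV[F]_n} :=
  [set p | (p.1 \notin [set k *: e | k : F]) &&
     (p.2 \notin [set k.1 *: e + k.2 *: p.1 | k : F * F])].

Lemma flag_pairs_unit (F : finFieldType) (e y z : 'rV[F]_3) :
  e != 0 -> (y, z) \in flag_pairs e ->
  (col_mx e (col_mx y z) : 'M_3) \in unitmx.
Proof.
move=> e0; rewrite inE /= => /andP[ye zey].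
rewrite -row_free_unit; apply: inj_row_free => v.
pose v' : 'rV_(1 + (1 + 1)) := v.
change (v' *m col_mx e (col_mx y z) = 0 -> v' = 0).
rewrite -[v']hsubmxK -[rsubmx v']hsubmxK.
rewrite [lsubmx v']mx11_scalar [lsubmx (rsubmx v')]mx11_scalar.
rewrite [rsubmx (rsubmx v')]mx11_scalar.
move: (lsubmx v' _ _) (lsubmx (rsubmx v') _ _) => k l.
move: (rsubmx (rsubmx v') _ _) => r.
rewrite !mul_row_col !mul_scalar_mx => keq.
have r0 : r = 0.
  apply: contraNeq zey => r0; apply/imsetP.
  exists (- (r^-1 * k), - (r^-1 * l)) => //=.
  apply: (scalerI r0); rewrite scalerDr !scalerA !mulrN !mulVKf // !scaleNr.
  by apply/eqP; rewrite -opprD -addr_eq0 addrC -addrA keq.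
move: keq; rewrite r0 scale0r addr0 => keq.
have l0 : l = 0.
  apply: contraNeq ye => l0; apply/imsetP; exists (- (l^-1 * k)) => //=.
  apply: (scalerI l0); rewrite !scalerA !mulrN !mulVKf // !scaleNr.
  by apply/eqP; rewrite -addr_eq0 addrC keq.
move/eqP: keq; rewrite l0 scale0r addr0 scaler_eq0 (negPf e0) orbF => /eqP->.
by rewrite !raddf0 !row_mx0.
Qed.

Lemma card_flag_pairs_ge (F : finFieldType) (n : nat) (e : 'rV[F]_n) :
  ((#|F| ^ n - #|F|) * (#|F| ^ n - #|F| ^ 2) <= #|flag_pairs e|)%N.
Proof.
have cardN (I : finType) (g : I -> 'rV[F]_n) (k : nat) : #|I| = k ->
    (#|F| ^ n - k <= #|[pred v | v \notin [set g i | i : I]]|)%N.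
  move=> Ik; rewrite -[n in (_ ^ n)%N]mul1n -card_mx.
  rewrite -(cardC [pred v in [set g i | i : I]]) leq_subLR leq_add2r.
  by rewrite -Ik; apply: leq_imset_card.
rewrite -sum1_card.
rewrite (eq_bigl (fun p => (p.1 \notin [set k *: e | k : F]) &&
  (p.2 \notin [set k.1 *: e + k.2 *: p.1 | k : F * F])));
  last by move=> p; rewrite inE.
rewrite -(pair_big_dep (fun y => y \notin [set k *: e | k : F])
  (fun y z => z \notin [set k.1 *: e + k.2 *: y | k : F * F]) (fun _ _ => 1%N)).
apply: leq_trans (leq_mul (cardN _ (fun k => k *: e) _ erefl) (leqnn _)) _.
rewrite -sum_nat_const; apply: leq_sum => y _; rewrite sum1_card.
by apply: (cardN _ (fun k : F * F => k.1 *: e + k.2 *: y)); rewrite card_prod.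
Qed.

Lemma ex_between_card (T : finType) (A B : {set T}) (n : nat) :
  A \subset B -> (#|A| <= n <= #|B|)%N ->
  exists C : {set T}, [/\ A \subset C, C \subset B & #|C| = n].
Proof.
move=> sAB; elim: n => [|n IHn] /andP[leAn lenB].
  by exists A; split=> //; apply/eqP; rewrite -leqn0.
move: leAn; rewrite leq_eqVlt => /orP[/eqP cA|]; first by exists A.
rewrite ltnS => leAn; have [|C [sAC sCB cC]] := IHn; first by rewrite leAn ltnW.
have /subsetPn[x Bx Cx] : ~~ (B \subset C).
  by apply: contraTN lenB => /subset_leq_card; rewrite cC -leqNgt.
exists (x |: C); split; last by rewrite cardsU1 Cx cC.
  by exact: fintype.subset_trans sAC (finset.subsetUr _ _).
by rewrite finset.subUset finset.sub1set Bx.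
Qed.

Lemma cubic_size_monic (F : fieldType) (a b c : F) :
  let m := 'X^3 + a *: 'X^2 + b *: 'X + c%:P in
  size m = 4%N /\ m \is monic.
Proof.
pose l := a *: 'X^2 + b *: 'X + c%:P.
have low : (size l < size ('X^3 : {poly F}))%N.
  rewrite size_polyXn ltnS (leq_trans (size_polyD _ _)) // geq_max.
  rewrite (leq_trans (size_polyC_leq1 _)) // andbT.
  rewrite (leq_trans (size_polyD _ _)) // geq_max.
  rewrite (leq_trans (size_scale_leq _ _)) ?size_polyXn //.
  by rewrite (leq_trans (size_scale_leq _ _)) ?size_polyX.
rewrite /= -2!addrA [a *: 'X^2 + _]addrA -/l.
by rewrite monicE lead_coefDl // size_polyDl // size_polyXn lead_coefXn.
Qed.

(** * Core sets from triples *)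

Lemma core_unit_nonunit (F : fieldType) (m : {poly F}) (S : set 'M[F]_3)
    (A B C : 'M[F]_3) :
  irreducible_poly m -> size m = 4%N -> S `<=` minpoly_class m ->
  S A -> S B -> S C -> A <> B -> A <> C ->
  B - A \in unitmx -> C - A \notin unitmx -> core S.
Proof.
move=> irrm szm Sm SA SB SC nAB nAC uBA uCA.
apply: (core_left_nullspace_neq irrm szm Sm SA SB SC) => // eqn.
move: uCA; rewrite unitmxE unitfE negbK => /det0P[v v0 vCA].
have : left_nullspace (C - A) v by [].
rewrite -eqn /left_nullspace /= => vBA; move/eqP: v0; apply.
by rewrite -[v](mulmxK uBA) vBA mul0mx.
Qed.

Lemma ex_core_card (F : finFieldType) (a b c : F) (m : {poly F}) (n : nat) :
  m = 'X^3 + a *: 'X^2 + b *: 'X + c%:P -> irreducible_poly m ->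
  (3 <= n <= (#|F| ^ 3 - #|F| ^ 2) * (#|F| ^ 3 - #|F|))%N ->
  exists T : {set 'M[F]_3},
    [/\ [set` T] `<=` minpoly_class m, #|T| = n & core [set` T]].
Proof.
move=> mE irrm /andP[n3 nN].
have [szm monm] : size m = 4%N /\ m \is monic.
  by rewrite mE; apply: cubic_size_monic.
pose e : 'rV[F]_3 := delta_mx 0 0.
have e0 : e != 0.
  by apply/eqP => /matrixP/(_ 0 0)/eqP; rewrite !mxE !eqxx oner_eq0.
have ex y z : (y, z) \in flag_pairs e ->
    exists A, [/\ minpoly_class m A, e *m A = y & y *m A = z].
  move=> yz; apply: (minpoly_class_cyclic mE irrm monm).
  exact: flag_pairs_unit.
pose CM : {set 'M[F]_3} := [set A | mxminpoly A == m]%SET.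
(* The image of C(m) under A |-> (eA, eA^2) contains every flag pair. *)
have leW : (#|flag_pairs e| <= #|CM|)%N.
  apply: leq_trans (leq_imset_card (fun A => (e *m A, e *m A *m A)) CM).
  apply/subset_leq_card/fintype.subsetP => -[y z] /ex[A [mA eA yA]].
  by apply/imsetP; exists A; rewrite ?eA ?yA // inE; apply/eqP.
rewrite mulnC in nN; have nW := leq_trans nN (card_flag_pairs_ge e).
have [[y z] yz] : exists p, p \in flag_pairs e.
  by apply/card_gt0P/(leq_trans _ nW)/(leq_trans _ n3).
(* Adding e to y or to z does not change the spans involved. *)
have yze : (y, z + e) \in flag_pairs e.
  move: yz; rewrite !inE /= => /andP[-> zP]; apply: contra zP.
  case/imsetP=> -[k l] _ /= zE; apply/imsetP; exists (k - 1, l) => //=.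
  by rewrite scalerBl scale1r addrAC -zE addrK.
have yez : (y + e, z) \in flag_pairs e.
  move: yz; rewrite !inE /= => /andP[yP zP]; apply/andP; split.
    apply: contra yP => /imsetP[k _ yE]; apply/imsetP; exists (k - 1) => //.
    by rewrite scalerBl scale1r -yE addrK.
  apply: contra zP => /imsetP[[k l] _ /= ->]; apply/imsetP.
  exists (k + l, l) => //=.
  by rewrite scalerDr scalerDl addrCA addrC.
(* eB = y = eA puts e in the left nullspace of B - A, whereas e(C - A) = e is nonzero. *)
have [A [mA eA yA]] := ex _ _ yz.
have [B [mB eB yB]] := ex _ _ yze.
have [C [mC eC yC]] := ex _ _ yez.
have nAB : A <> B.
  move=> AB; move/eqP: yB; rewrite -AB yA -subr_eq0 opprD addNKr oppr_eq0.
  by rewrite (negPf e0).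
have neAC : e *m (C - A) <> 0.
  by rewrite mulmxBr eA eC addrAC subrr add0r; apply/eqP.
have nAC : A <> C by move=> eqAC; apply: neAC; rewrite eqAC subrr mulmx0.
(* Any T of size n between the triple and C(m) will do. *)
have [|| T [sT TC cT]] := @ex_between_card _ [set A; B; C]%SET CM n.
- rewrite !finset.subUset !finset.sub1set !inE.
  by apply/andP; split; [apply/andP; split|]; apply/eqP.
- rewrite (leq_trans nW leW) andbT (leq_trans _ n3) //.
  rewrite (leq_trans (leq_card_setU _ _)) // cards1 addn1 cards2 ltnS.
  by case: eqP.
have Tm : [set` T] `<=` minpoly_class m.
  by move=> X /(fintype.subsetP TC); rewrite inE => /eqP.
exists T; split=> //.
have TA : [set` T] A by apply: (fintype.subsetP sT); rewrite !inE eqxx.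
have TB : [set` T] B by apply: (fintype.subsetP sT); rewrite !inE eqxx orbT.
have TC' : [set` T] C by apply: (fintype.subsetP sT); rewrite !inE eqxx !orbT.
apply: (core_left_nullspace_neq irrm szm Tm TA TB TC') => // eqn.
have : left_nullspace (B - A) e.
  by rewrite /left_nullspace /= mulmxBr eA eB subrr.
by rewrite eqn.
Qed.

Theorem corollary4p4 :
  (forall (F : fieldType) (a b c : F) (m : {poly F}),
     m = 'X^3 + a *: 'X^2 + b *: 'X + c%:P ->
     irreducible_poly m ->
     forall S : set 'M[F]_3, S `<=` minpoly_class m ->
     ((exists A B C : 'M[F]_3,
         [/\ S A, S B & S C] /\ [/\ A <> B, A <> C & B <> C] /\
         B - A \in unitmx /\ C - A \notin unitmx) ->
      core S) /\
     ((exists A B C : 'M[F]_3,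
         [/\ S A, S B & S C] /\ [/\ A <> B, A <> C & B <> C] /\
         left_nullspace (B - A) <> left_nullspace (C - A)) ->
      core S)) /\
  (forall (F : finFieldType) (q : nat) (a b c : F) (m : {poly F}),
     #|F| = q ->
     m = 'X^3 + a *: 'X^2 + b *: 'X + c%:P ->
     irreducible_poly m ->
     forall n : nat,
       (3 <= n <= (q ^ 3 - q ^ 2) * (q ^ 3 - q))%N ->
       exists T : {set 'M[F]_3},
         [/\ [set` T] `<=` minpoly_class m, #|T| = n & core [set` T]]).
Proof.
split.
  move=> F a b c m mE irrm S Sm.
  have szm : size m = 4%N by rewrite mE; apply: (cubic_size_monic a b c).1.
  split=> -[A [B [C [[SA SB SC] [[nAB nAC _]]]]]].
    by case; apply: (core_unit_nonunit irrm szm Sm SA SB SC).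
  exact: (core_left_nullspace_neq irrm szm Sm SA SB SC).
move=> F q a b c m <- mE irrm n nq; exact: (ex_core_card mE irrm nq).
Qed.
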